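(* Let $H=G_{\mathfrak f^0}$ be a half-edged graph (HEG) with underlying graph $G$ and set of half-edges $\mathfrak f^0$, and let $\mathcal T_H(x,y,t)$ be defined by $$\mathcal T_{G_{\mathfrak f^0}}(x,y,t)=t^{|\mathfrak f^0|+2n(G)}\,T_G\!\left(X,\frac{Y}{t^2}\right),\qquad X=t^2(x-1)+1,\quad Y=y+t^2-1,$$ where $T_G$ is the Tutte polynomial of $G$ and $n(G)$ its nullity. Then: (a) $\mathcal T_{(E_n)_{\mathfrak f^0}}(x,y,t)=t^{|\mathfrak f^0|}$, where $(E_n)_{\mathfrak f^0}$ is the HEG with $n$ vertices, no edges and $|\mathfrak f^0|$ half-edges. (b) For an edge $e$ of $H$, $$\mathcal T_H(x,y,t)=\begin{cases}X\,\mathcal T_{H-e}(x,y,t)&\text{if } e \text{ is a bridge},\\ Y\,\mathcal T_{H/e}(x,y,t)&\text{if } e\text{ is a loop},\\ t^2\,\mathcal T_{H-e}(x,y,t)+\mathcal T_{H/e}(x,y,t)&\text{if } e \text{ is ordinary}.\end{cases}$$ (c) $\mathcal T_H(x,y,t)=\mathcal T_{H\vee e}(x,y,t)+\mathcal T_{H/e}(x,y,t)$ if $e$ is ordinary. (d) $$\mathcal T_H(x,y,t)=\sum_{A\Subset H}(x-1)^{r(H)-r(A)}(y-1)^{n(A)}\,t^{|\mathfrak f^0(A)|}.$$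
   Context: Graphs are finite and may have loops and multiple edges. For a graph with vertex set $\mathcal V$, edge set $\mathcal E$ and $k$ connected components, $r=|\mathcal V|-k$ (rank) and $n=|\mathcal E|+k-|\mathcal V|$ (nullity). The Tutte polynomial is $T_G(x,y)=\sum_{A\subset G}(x-1)^{r(G)-r(A)}(y-1)^{n(A)}$, summed over spanning subgraphs. A half-edged graph (HEG) $G_{\mathfrak f^0}$ is a graph $G$ (its underlying graph) together with a finite set $\mathfrak f^0$ of half-edges, each associated with a unique vertex. Rank and nullity of a HEG are those of its underlying graph. An edge is ordinary if it is neither a bridge nor a loop. $H-e$ deletes $e$ keeping all half-edges. The cut $H\vee e$ deletes $e$ and attaches one half-edge to each end vertex of $e$ (two half-edges to the same vertex if $e$ is a loop). The contraction $H/e$ of a non-loop edge removes $e$ and identifies its end vertices into a vertex carrying all their half-edges and remaining edges; for a loop $e$, $H/e=H-e$. A spanning c-subgraph $A\Subset H$ is obtained by choosing a subset $\mathcal E_A$ of edges and cutting all edges not in $\mathcal E_A$ (all vertices and all half-edges are kept); $\mathfrak f^0(A)$ is the set of half-edges of $A$, consisting of $\mathfrak f^0$ and the half-edges created by the cuts. *)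

(* Defs.v *)
From HB Require Import structures.
From mathcomp Require Import all_boot all_order all_algebra.

Set Implicit Arguments.
Unset Strict Implicit.
Unset Printing Implicit Defensive.

Import GRing.Theory.

(* Finite multigraphs, loops allowed. The two ends of an edge are stored as an
   ordered pair; the order is an encoding artefact on which none of the graph
   invariants below depends. *)
Record graph := Graph {
  vert : finType;
  edge : finType;
  ends : edge -> vert * vert
}.
Arguments ends {g}.

Definition adj (G : graph) : rel (vert G) :=
  fun u v => [exists f : edge G, (ends f == (u, v)) || (ends f == (v, u))].

Definition ncomp (G : graph) : nat := n_comp (@adj G) (vert G).

(* Truncation never occurs in the two subtractions: a graph has at most |V|
   components, and at least |V| - |E|. *)
Definition rank (G : graph) : nat := #|vert G| - ncomp G.
Definition nullity (G : graph) : nat := #|edge G| + ncomp G - #|vert G|.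

Definition spanning_subgraph (G : graph) (A : {set edge G}) : graph :=
  @Graph (vert G) {f : edge G | f \in A} (fun f => ends (val f)).

Definition is_loop (G : graph) (e : edge G) : bool := (ends e).1 == (ends e).2.

Definition is_bridge (G : graph) (e : edge G) : bool :=
  ncomp G < ncomp (spanning_subgraph [set~ e]).

Definition is_ordinary (G : graph) (e : edge G) : bool :=
  ~~ is_bridge e && ~~ is_loop e.

Record heg := Heg {
  underlying :> graph;
  half_edge : finType;
  att : half_edge -> vert underlying
}.
Arguments att {h}.

Definition is_edgeless (n : nat) (H : heg) : Prop :=
  #|vert H| = n /\ #|edge H| = 0.

Definition delete (H : heg) (e : edge H) : heg :=
  @Heg (spanning_subgraph [set~ e]) (half_edge H) att.

(* The two half-edges created by cutting f are (f, false) and (f, true), one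
   for each component of ends f, hence both at the same vertex if f is a
   loop. *)
Definition csub_att (H : heg) (A : {set edge H})
    (h : half_edge H + {f : edge H | f \notin A} * bool) : vert H :=
  match h with
  | inl h0 => att h0
  | inr (f, b) => if b then (ends (val f)).2 else (ends (val f)).1
  end.

Definition spanning_csub (H : heg) (A : {set edge H}) : heg :=
  @Heg (spanning_subgraph A)
       (half_edge H + {f : edge H | f \notin A} * bool)%type
       (@csub_att H A).

Definition cut (H : heg) (e : edge H) : heg := spanning_csub [set~ e].

(* The merged vertex is represented by the first end of e: the second end is
   sent to it and disappears from the vertex set. *)
Definition identify (G : graph) (e : edge G) (w : vert G) : vert G :=
  if w == (ends e).2 then (ends e).1 else w.

Definition merged_vert (G : graph) (e : edge G) : finType :=
  {w : vert G | w \in codom (identify e)}.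

Definition to_merged (G : graph) (e : edge G) (w : vert G) : merged_vert e :=
  Sub (identify e w) (codom_f (identify e) w).

Definition contract_graph (G : graph) (e : edge G) : graph :=
  @Graph (merged_vert e) {f : edge G | f \in [set~ e]}
    (fun f => (to_merged e (ends (val f)).1, to_merged e (ends (val f)).2)).

Definition contract (H : heg) (e : edge H) : heg :=
  if is_loop e then delete e
  else @Heg (contract_graph e) (half_edge H) (fun h => to_merged e (att h)).

Local Open Scope ring_scope.

Definition tutte (R : comNzRingType) (G : graph) (x y : R) : R :=
  \sum_(A : {set edge G})
     (x - 1) ^+ (rank G - rank (spanning_subgraph A)) *
     (y - 1) ^+ nullity (spanning_subgraph A).

Definition argX (R : comNzRingType) (x t : R) : R := t ^+ 2 * (x - 1) + 1.
Definition argY (R : comNzRingType) (y t : R) : R := y + t ^+ 2 - 1.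

(* Meaningful when t is a unit. With R the field of fractions of Z[x, y, t]
   this is the generic polynomial; other R give its specializations. *)
Definition heg_tutte (R : comUnitRingType) (H : heg) (x y t : R) : R :=
  t ^+ (#|half_edge H| + 2 * nullity H) * tutte H (argX x t) (argY y t / t ^+ 2).

(* Main.v *)
(* Substituting X and Y / t^2 into the subset expansion of T_G turns the term of A
   into (x-1)^(r(G)-r(A)) ((y-1)/t^2)^n(A) t^(2(r(G)-r(A))); since
   r(A) + n(A) = |A|, the total power of t is |f0| + 2 |E \ A|, which is (d).
   The recurrences follow by pairing in (d) the subsets A and A + e with e not in A:
   A is a subset of H - e, and A + e has the same component structure as its image
   in H / e.  Only the effect of e on the number of components matters: adding e
   merges two components when its ends are not already connected. *)

Require Import Defs.
From mathcomp Require Import all_boot all_order all_algebra.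
From mathcomp Require Import zify ring.

Set Implicit Arguments.
Unset Strict Implicit.
Unset Printing Implicit Defensive.

Import GRing.Theory.
Local Open Scope ring_scope.

(** * Pairing the subsets that avoid a point with those that contain it *)

Lemma notin_imset_val (T : finType) (e : T) (B : {set {f : T | f \in [set~ e]}}) :
  e \notin [set val f | f in B].
Proof. by apply/imsetP=> -[g _ eg]; have := valP g; rewrite /= -eg !inE eqxx. Qed.

(** The right-hand index type is the edge type of both [delete e] (any [e]) and [contract_graph e],
    so the sums for $H$, $H-e$ and $H/e$ can be compared term by term. *)
Lemma sum_setsD1 (V : nmodType) (T : finType) (e : T) (F : {set T} -> V) :
  \sum_(A : {set T}) F A =
  \sum_(B : {set {f : T | f \in [set~ e]}})
     (F [set val f | f in B] + F (e |: [set val f | f in B])).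
Proof.
pose S : finType := {f : T | f \in [set~ e]}.
pose up (B : {set S}) : {set T} := [set val f | f in B].
pose dn (A : {set T}) : {set S} := [set f | val f \in A].
have upK B : dn (up B) = B.
  by apply/setP=> f; rewrite inE mem_imset //; apply: val_inj.
have dnK A : up (dn A) = A :\ e.
  apply/setP=> f; rewrite !inE; apply/imsetP/andP=> [[g]|[fe fA]].
    by rewrite inE => gA ->; split=> //; have := valP g; rewrite !inE.
  by have fe' : f \in [set~ e] by [rewrite !inE]; exists (Sub f fe'); rewrite ?inE.
have eup B : e \notin up B by apply: notin_imset_val.
rewrite (bigID (fun A : {set T} => e \in A)) /= addrC big_split /=; congr (_ + _).
  rewrite (reindex_onto up dn) => [|A eA]; last first.
    by rewrite dnK; apply/setDidPl; rewrite disjoint_sym disjoints1.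
  by apply: eq_bigl => B; rewrite upK eqxx eup.
rewrite (reindex_onto (fun B => e |: up B) dn) => [|A eA]; last by rewrite dnK setD1K.
apply: eq_bigl => B; rewrite setU11 /= -{2}[B]upK; apply/eqP/setP=> f.
rewrite !inE; have := valP f; rewrite !inE => /negPf -> //.
Qed.

(** * Counting connected components *)

Local Open Scope nat_scope.

Lemma connect_adj_sym (K : graph) : connect_sym (@adj K).
Proof.
by apply: sym_connect_sym => u v; apply: eq_existsb => f; rewrite orbC.
Qed.

Lemma connect_invariant (T : finType) (S : eqType) (r : rel T) (h : T -> S) :
  (forall u v, r u v -> h u = h v) ->
  forall u v, connect r u v -> h u = h v.
Proof.
move=> hr u v /connectP[p]; elim: p u => [u _ -> //|w p IH u /= /andP[/hr -> wp]].
exact: IH.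
Qed.

(** The fibres of [h] are the components, so [h] takes all its values on the roots and is injective
    there. The target [T] is free, which lets two different graphs be counted by images in one
    type. *)
Lemma ncomp_imset (K : graph) (T : finType) (h : vert K -> T) :
  (forall u v, (h u == h v) = connect (@adj K) u v) ->
  ncomp K = #|h @: [set: vert K]|.
Proof.
move=> hP; have sK := @connect_adj_sym K.
have -> : h @: [set: vert K] = h @: [set u in roots (@adj K)].
  apply/setP=> z; apply/imsetP/imsetP=> -[u _ ->]; last by exists u.
  exists (fingraph.root (@adj K) u); first by rewrite inE; apply: roots_root.
  by apply/eqP; rewrite hP connect_root.
rewrite card_in_imset => [|u v]; last first.
  rewrite !inE => /eqP ru /eqP rv /eqP; rewrite hP -(root_connect sK) ru rv.
  by move/eqP.
by rewrite cardsE; apply: eq_card => u; rewrite !inE andbT.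
Qed.

Lemma adj_subP (G : graph) (A : {set edge G}) (u v : vert G) :
  reflect (exists2 f, f \in A & (ends f == (u, v)) || (ends f == (v, u)))
          (@adj (spanning_subgraph A) u v).
Proof.
apply: (iffP existsP) => [[f fuv]|[f fA fuv]]; first by exists (val f) => //; apply: valP.
by exists (exist _ f fA).
Qed.

Lemma sub_connect_sub (G : graph) (A B : {set edge G}) : A \subset B ->
  subrel (connect (@adj (spanning_subgraph A))) (connect (@adj (spanning_subgraph B))).
Proof.
move=> AB; apply: connect_sub => u v /adj_subP[f fA fuv].
by apply: connect1; apply/adj_subP; exists f => //; apply: (subsetP AB).
Qed.

Lemma connect_ends (G : graph) (A : {set edge G}) (e : edge G) : e \in A ->
  connect (@adj (spanning_subgraph A)) (ends e).1 (ends e).2.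
Proof.
by move=> eA; apply: connect1; apply/adj_subP; exists e; rewrite -?surjective_pairing ?eqxx.
Qed.

(** The components of [e |: A] are obtained from those of [A] by redirecting the root of the second
    end of [e] to the root of the first. This loses one root exactly when the two roots differ. *)
Lemma ncomp_setU1 (G : graph) (A : {set edge G}) (e : edge G) :
  ncomp (spanning_subgraph A) =
  ncomp (spanning_subgraph (e |: A)) +
  ~~ connect (@adj (spanning_subgraph A)) (ends e).1 (ends e).2.
Proof.
set K := spanning_subgraph A; set L := spanning_subgraph (e |: A).
have sK := @connect_adj_sym K; have sL := @connect_adj_sym L.
have KL := @sub_connect_sub _ A (e |: A) (subsetUr _ _).
set a := (ends e).1; set b := (ends e).2.
pose rt := fingraph.root (@adj K).
have rtP u v : (rt u == rt v) = connect (@adj K) u v by apply: root_connect.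
pose g (u : vert G) : vert G := if rt u == rt b then rt a else rt u.
have ab : connect (@adj L) a b by apply: connect_ends; rewrite setU11.
have uru u : connect (@adj L) u (rt u) by apply: KL; apply: connect_root.
have ug u : connect (@adj L) u (g u).
  rewrite /g; case: eqP => [ub|_ //].
  apply: connect_trans (uru u) _; rewrite ub.
  apply: connect_trans (_ : connect (@adj L) (rt b) b) _; first by rewrite sL.
  by apply: connect_trans (uru a); rewrite sL.
(* The fibres of [g] are the components of [L]: each [u] is joined to [g u] in [L], and [g] is
   constant along every edge of [e |: A]. *)
have gP u v : (g u == g v) = connect (@adj L) u v.
  apply/eqP/idP=> [guv|]; first by apply: connect_trans (ug u) _; rewrite guv sL.
  apply: connect_invariant => {}u {}v /adj_subP[f].
  have gab : g a = g b by rewrite /g eqxx if_same.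
  rewrite in_setU1 => /predU1P[->|fA fuv].
    by rewrite [ends e]surjective_pairing => /orP[]/eqP[<- <-].
  suff /eqP ruv : rt u == rt v by rewrite /g ruv.
  by rewrite rtP; apply: connect1; apply/adj_subP; exists f.
rewrite (@ncomp_imset L _ g gP) (@ncomp_imset K _ rt rtP) -rtP.
have [rab|rab] := eqVneq (rt a) (rt b).
  rewrite addn0; congr #|pred_of_set _|; apply: eq_imset => u.
  by rewrite /g rab; case: eqP.
(* With distinct roots, [rt b] is the only value of [rt] that [g] never takes. *)
have -> : g @: [set: vert G] = (rt @: [set: vert G]) :\ rt b.
  apply/setP=> z; rewrite in_setD1; apply/imsetP/andP=> [[u _ ->]|[zb /imsetP[u _ zu]]].
    by rewrite /g; case: ifP => [_|/negbT]; split=> //; rewrite imset_f.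
  by exists u => //; rewrite /g -zu (negPf zb).
by rewrite (cardsD1 (rt b)) imset_f // addnC.
Qed.

Lemma sub_connect_invariant (G : graph) (A : {set edge G}) (T : eqType)
    (h : vert G -> T) :
  (forall f, f \in A -> h (ends f).1 = h (ends f).2) ->
  forall u v, connect (@adj (spanning_subgraph A)) u v -> h u = h v.
Proof.
move=> hA; apply: connect_invariant => u v /adj_subP[f /hA].
by rewrite [ends f]surjective_pairing => hf /orP[]/eqP[<- <-].
Qed.

Lemma ncomp_set0 (G : graph) : ncomp (@spanning_subgraph G set0) = #|vert G|.
Proof.
rewrite (@ncomp_imset _ _ id) ?imset_id ?cardsT // => u v.
apply/eqP/idP=> [->//|]; apply: (@sub_connect_invariant G set0 _ id) => f.
by rewrite inE.
Qed.

Lemma ncomp_setT (G : graph) : ncomp (spanning_subgraph [set: edge G]) = ncomp G.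
Proof.
apply: eq_n_comp; apply: eq_connect => u v.
by apply/adj_subP/existsP=> [[f _ fuv]|[f fuv]]; exists f.
Qed.

(** Induction on the number of edges in [B]: each added edge lowers the count by at most one. *)
Lemma ncomp_setU (G : graph) (A B : {set edge G}) :
  ncomp (spanning_subgraph (A :|: B)) <= ncomp (spanning_subgraph A)
    <= ncomp (spanning_subgraph (A :|: B)) + #|B|.
Proof.
have [m] := ubnP #|B|; elim: m B => // m IH B ltBm.
have [->|[e eB]] := set_0Vmem B; first by rewrite setU0 cards0 addn0 leqnn.
have eD : B = e |: (B :\ e) by rewrite setD1K.
move: ltBm; rewrite (cardsD1 e) eB => /IH.
rewrite [X in _ -> is_true (_ <= _ <= ncomp (spanning_subgraph (A :|: X)) + _)]eD.
rewrite [X in _ -> is_true (ncomp (spanning_subgraph (A :|: X)) <= _ <= _)]eD.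
by rewrite setUCA (ncomp_setU1 (A :|: (B :\ e)) e); case: connect => /=; lia.
Qed.

(** * Rank and nullity in terms of component counts *)

Lemma ncomp_bounds (G : graph) :
  (ncomp G <= #|vert G|) && (#|vert G| <= #|edge G| + ncomp G).
Proof.
have := @ncomp_setU G set0 setT.
by rewrite set0U ncomp_setT ncomp_set0 cardsT [_ + ncomp G]addnC.
Qed.

Lemma ncomp_sub_ge (G : graph) (A : {set edge G}) :
  ncomp G <= ncomp (spanning_subgraph A).
Proof.
by have /andP[] := @ncomp_setU G A setT; rewrite setUT ncomp_setT.
Qed.

Lemma rank_nullity (G : graph) : rank G + nullity G = #|edge G|.
Proof. by have := ncomp_bounds G; rewrite /rank /nullity; lia. Qed.

Lemma rank_sub_le (G : graph) (A : {set edge G}) :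
  rank (spanning_subgraph A) <= rank G.
Proof. exact: leq_sub2l (ncomp_sub_ge A). Qed.

(** A spanning subgraph has the same vertices as [G], so these cancel in the difference of ranks;
    what remains is the component count, the quantity that the lemmas on [e] control. *)
Lemma rank_subB (G : graph) (A : {set edge G}) :
  rank G - rank (spanning_subgraph A) = ncomp (spanning_subgraph A) - ncomp G.
Proof.
have := ncomp_bounds G; have := ncomp_bounds (spanning_subgraph A).
by have := ncomp_sub_ge A; rewrite /rank /=; lia.
Qed.

Lemma card_edge_sub (G : graph) (A : {set edge G}) :
  #|edge (spanning_subgraph A)| = #|A|.
Proof. by rewrite card_sig; apply: eq_card. Qed.

Lemma nullity_sub (G : graph) (A : {set edge G}) :
  nullity (spanning_subgraph A) = #|A| + ncomp (spanning_subgraph A) - #|vert G|.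
Proof. by rewrite /nullity card_edge_sub. Qed.

(** With [D] the complement of [e], this carries counts made in $H-e$ back to edge sets of $H$. *)
Lemma ncomp_sub_sub (G : graph) (D : {set edge G})
    (B : {set edge (spanning_subgraph D)}) :
  ncomp (spanning_subgraph B) = ncomp (spanning_subgraph [set val f | f in B]).
Proof.
apply: eq_n_comp; apply: eq_connect => u v.
apply/adj_subP/adj_subP=> [[f fB fuv]|[f /imsetP[g gB ->] fuv]].
  by exists (val f); rewrite ?imset_f.
by exists g.
Qed.

(** * Effect of a bridge or a loop on component count and nullity *)

Lemma ncomp_setC1 (G : graph) (e : edge G) :
  ncomp (spanning_subgraph [set~ e]) = ncomp G + is_bridge e.
Proof.
have := ncomp_setU1 [set~ e] e; rewrite setUCr ncomp_setT /is_bridge => ->.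
by case: connect; rewrite ?addn0 ?addn1 ?ltnn ?ltnSn ?addn0 ?addn1.
Qed.

(** If [A] connected the ends of [e], so would the larger set of all edges other than [e], and [e]
    would not be a bridge. *)
Lemma bridge_ncomp (G : graph) (e : edge G) (A : {set edge G}) :
  is_bridge e -> e \notin A ->
  ncomp (spanning_subgraph A) = (ncomp (spanning_subgraph (e |: A))).+1.
Proof.
move=> be eA; rewrite (ncomp_setU1 A e) -addn1; congr (_ + _).
have := ncomp_setU1 [set~ e] e; rewrite setUCr ncomp_setT ncomp_setC1 be.
case cA: (connect (@adj (spanning_subgraph A)) _ _) => //.
have AC : A \subset [set~ e].
  by apply/subsetP=> f fA; rewrite !inE; apply: contraNneq eA => <-.
by rewrite (sub_connect_sub AC cA); lia.
Qed.

Lemma loop_ncomp (G : graph) (e : edge G) (A : {set edge G}) :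
  is_loop e -> ncomp (spanning_subgraph A) = ncomp (spanning_subgraph (e |: A)).
Proof. by move=> /eqP le; rewrite (ncomp_setU1 A e) le connect0 addn0. Qed.

Lemma loop_not_bridge (G : graph) (e : edge G) : is_loop e -> is_bridge e = false.
Proof.
move=> le; rewrite /is_bridge (loop_ncomp [set~ e] le).
by rewrite setUCr ncomp_setT ltnn.
Qed.

Lemma bridge_nullity (G : graph) (e : edge G) (A : {set edge G}) :
  is_bridge e -> e \notin A ->
  nullity (spanning_subgraph (e |: A)) = nullity (spanning_subgraph A).
Proof.
by move=> be eA; rewrite !nullity_sub (bridge_ncomp be eA) cardsU1 eA; lia.
Qed.

Lemma loop_nullity (G : graph) (e : edge G) (A : {set edge G}) :
  is_loop e -> e \notin A ->
  nullity (spanning_subgraph (e |: A)) = (nullity (spanning_subgraph A)).+1.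
Proof.
move=> le eA; rewrite !nullity_sub -(loop_ncomp A le) cardsU1 eA.
by have := ncomp_bounds (spanning_subgraph A); rewrite card_edge_sub /=; lia.
Qed.

(** * Vertices and components of a contraction *)

Lemma card_merged_vert (G : graph) (e : edge G) :
  ~~ is_loop e -> #|merged_vert e|.+1 = #|vert G|.
Proof.
move=> nle; have ab : (ends e).1 != (ends e).2 by [].
rewrite card_sig (@eq_card _ _ (predC1 (ends e).2)) ?cardC1 => [|w].
  by rewrite prednK //; apply/card_gt0P; exists (ends e).1.
rewrite !inE; apply/codomP/idP=> [[u ->]|wb]; first by rewrite /identify; case: ifPn.
by exists w; rewrite /identify (negPf wb).
Qed.

Lemma to_merged_val (G : graph) (e : edge G) (p : merged_vert e) :
  to_merged e (val p) = p.
Proof.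
apply: val_inj => /=; have /codomP[w ->] := valP p.
by rewrite /identify; case: (eqVneq w) => [_|/negPf->//]; rewrite if_same.
Qed.

(** Both counts are images of the root map of [L], the graph containing [e]: a vertex and its
    representative after merging have the same root in [L], and two merged vertices are connected in
    [C] exactly when their roots in [L] agree. *)
Lemma ncomp_contract (G : graph) (e : edge G) (B : {set edge (contract_graph e)}) :
  ncomp (spanning_subgraph B) =
  ncomp (spanning_subgraph (e |: [set val f | f in B])).
Proof.
set C := spanning_subgraph B; set L := spanning_subgraph _.
have sL := @connect_adj_sym L; have sC := @connect_adj_sym C.
pose rt := fingraph.root (@adj L); pose rtC := fingraph.root (@adj C).
have rtP u v : (rt u == rt v) = connect (@adj L) u v by apply: root_connect.
have rt_id w : rt (identify e w) = rt w.
  rewrite /identify; case: eqP => [->|//]; apply/eqP; rewrite rtP.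
  by apply: connect_ends; rewrite setU11.
have CL (p q : merged_vert e) : (rt (val p) == rt (val q)) = connect (@adj C) p q.
  rewrite rtP; apply/idP/idP=> [pq|].
    (* The root in [C] of the merged vertex is constant along the edges of [L]: [e] collapses to one
       vertex, and the other edges survive in [C]. *)
    suff /eqP : rtC (to_merged e (val p)) = rtC (to_merged e (val q)).
      by rewrite !to_merged_val root_connect.
    move: pq; apply: (@sub_connect_invariant _ _ _ (fun w => rtC (to_merged e w))) => f.
    rewrite in_setU1 => /predU1P[->|/imsetP[g gB ->]].
      by congr rtC; apply: val_inj; rewrite /= /identify eqxx if_same.
    by apply/eqP; rewrite root_connect //; apply: (connect_ends gB).
  rewrite -rtP => pq; apply/eqP; move: p q pq.
  apply: (@sub_connect_invariant _ B _ (fun p : merged_vert e => rt (val p))).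
  move=> f fB /=; rewrite !rt_id; apply/eqP; rewrite rtP.
  by apply: connect_ends; rewrite setU1r ?imset_f.
rewrite (@ncomp_imset C _ (fun p : merged_vert e => rt (val p)) CL) (ncomp_imset rtP).
congr #|pred_of_set _|.
apply/setP=> z; apply/imsetP/imsetP=> -[w _ ->]; first by exists (val w).
by exists (to_merged e w) => //; rewrite -[LHS]rt_id.
Qed.

(** * The subset expansion of the HEG polynomial and its recurrences *)

Local Open Scope ring_scope.

Section HegTutte.
Variables (R : comUnitRingType) (x y t : R).
Hypothesis ht : t \is a GRing.unit.

(** The summand of (d) as a function of its three exponents, so that comparing terms becomes
    arithmetic on exponents. *)
Definition csub_weight (c n m : nat) : R := (x - 1) ^+ c * (y - 1) ^+ n * t ^+ m.

Lemma csub_weightSl c n m : csub_weight c.+1 n m = (x - 1) * csub_weight c n m.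
Proof. by rewrite /csub_weight exprS !mulrA. Qed.

Lemma csub_weightSm c n m : csub_weight c n.+1 m = (y - 1) * csub_weight c n m.
Proof. by rewrite /csub_weight exprS mulrCA !mulrA. Qed.

Lemma csub_weight_halfS c n h k :
  csub_weight c n (h + 2 * k.+1) = t ^+ 2 * csub_weight c n (h + 2 * k).
Proof. by rewrite /csub_weight mulnS addnCA [t ^+ (2 + _)]exprD mulrCA. Qed.

Lemma heg_tutteE (H : heg) :
  heg_tutte H x y t =
  \sum_(A : {set edge H})
     csub_weight (rank H - rank (spanning_subgraph A)) (nullity (spanning_subgraph A))
       (#|half_edge H| + 2 * #|~: A|).
Proof.
rewrite /heg_tutte /tutte mulr_sumr; apply: eq_bigr => A _.
have -> : argX x t - 1 = t ^+ 2 * (x - 1) by rewrite /argX addrK.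
have -> : argY y t / t ^+ 2 - 1 = (y - 1) / t ^+ 2.
  have -> : argY y t = y - 1 + t ^+ 2 by rewrite /argY addrAC.
  by rewrite mulrDl mulrV ?unitrX // addrK.
set d := (rank H - _)%N; set n := nullity (spanning_subgraph A).
set h := #|half_edge H|; set k := #|~: A|.
(* The exponents agree because rank plus nullity is the number of edges, both for $H$ and for [A].
   The factor [t ^+ (2 * n)] stands on the right to avoid a negative power. *)
have key : t ^+ (h + 2 * nullity H) * t ^+ (2 * d) = t ^+ (h + 2 * k) * t ^+ (2 * n).
  rewrite -!exprD; congr (t ^+ _).
  have := rank_nullity H; have := rank_nullity (spanning_subgraph A).
  have := cardsC A; have := rank_sub_le A; rewrite card_edge_sub /d /n /k; lia.
have nV : t ^+ (2 * n) * (t ^+ (2 * n))^-1 = 1 by rewrite mulrV ?unitrX.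
rewrite [_ ^+ d]exprMn [_ ^+ n]exprMn exprVn -!exprM /csub_weight.
(* Once the power of [t] and its inverse are abstracted to [u] and [v], only [u * v = 1] and [key]
   are needed, and [ring] does the rest. *)
move: nV key; move: (_^-1) => v; move: (t ^+ (2 * n)) => u nV key.
transitivity (t ^+ (h + 2 * nullity H) * t ^+ (2 * d) * (x - 1) ^+ d * (y - 1) ^+ n * v).
  by ring.
by rewrite key -[RHS]mulr1 -nV; ring.
Qed.

(** The complement of [B] is taken among the edges other than [e]; the successor in the first term
    counts [e] itself as cut. *)
Lemma heg_tutte_split (H : heg) (e : edge H) :
  heg_tutte H x y t =
  \sum_(B : {set {f : edge H | f \in [set~ e]}})
     let A := [set val f | f in B] in
     (csub_weight (ncomp (spanning_subgraph A) - ncomp H)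
        (nullity (spanning_subgraph A)) (#|half_edge H| + 2 * #|~: B|.+1)
      + csub_weight (ncomp (spanning_subgraph (e |: A)) - ncomp H)
        (nullity (spanning_subgraph (e |: A))) (#|half_edge H| + 2 * #|~: B|)).
Proof.
rewrite heg_tutteE (sum_setsD1 e); apply: eq_bigr => B _; cbv zeta.
have cB : #|[set val f | f in B]| = #|B| by rewrite card_imset //; apply: val_inj.
have eB := notin_imset_val B.
have cU : #|e |: [set val f | f in B]| = #|B|.+1 by rewrite cardsU1 eB cB.
have cS : (#|B| + #|~: B|).+1 = #|edge H|.
  by rewrite cardsC (card_edge_sub [set~ e]) cardsC1 prednK //; apply/card_gt0P; exists e.
have := cardsC [set val f | f in B]; have := cardsC (e |: [set val f | f in B]).
rewrite cB cU !rank_subB => *; congr (csub_weight _ _ _ + csub_weight _ _ _); lia.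
Qed.

Lemma heg_tutte_delete (H : heg) (e : edge H) :
  heg_tutte (delete e) x y t =
  \sum_(B : {set {f : edge H | f \in [set~ e]}})
     let A := [set val f | f in B] in
     csub_weight (ncomp (spanning_subgraph A) - ncomp (spanning_subgraph [set~ e]))
       (nullity (spanning_subgraph A)) (#|half_edge H| + 2 * #|~: B|).
Proof.
rewrite heg_tutteE; apply: eq_bigr => B _; cbv zeta.
rewrite rank_subB !nullity_sub !ncomp_sub_sub card_imset //; exact: val_inj.
Qed.

Lemma heg_tutte_contract (H : heg) (e : edge H) : ~~ is_loop e ->
  heg_tutte (contract e) x y t =
  \sum_(B : {set {f : edge H | f \in [set~ e]}})
     let A := [set val f | f in B] in
     csub_weight (ncomp (spanning_subgraph (e |: A)) - ncomp H)
       (nullity (spanning_subgraph (e |: A))) (#|half_edge H| + 2 * #|~: B|).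
Proof.
move=> nle; rewrite /contract (negPf nle) heg_tutteE; apply: eq_bigr => B _; cbv zeta.
(* This is [ncomp_contract] for the full edge set of the contraction, which together with [e] gives
   all edges of $H$. *)
have cT : ncomp (contract_graph e) = ncomp H.
  rewrite -ncomp_setT ncomp_contract -[RHS]ncomp_setT; congr (ncomp (spanning_subgraph _)).
  apply/setP=> f; rewrite !inE; have [//|fe] := eqVneq f e.
  have fD : f \in [set~ e] by rewrite !inE.
  by apply/imsetP; exists (Sub f fD).
have eB := notin_imset_val B.
rewrite rank_subB !nullity_sub /= ncomp_contract cT cardsU1 eB.
rewrite card_imset; last exact: val_inj.
(* Contraction removes one edge and one vertex, so the nullities agree. *)
rewrite -(card_merged_vert nle); congr csub_weight; lia.
Qed.

Lemma heg_tutte_bridge (H : heg) (e : edge H) : is_bridge e ->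
  heg_tutte H x y t = argX x t * heg_tutte (delete e) x y t.
Proof.
move=> be; rewrite (heg_tutte_split e) heg_tutte_delete mulr_sumr.
apply: eq_bigr => B _; cbv zeta; have eB := notin_imset_val B.
(* Without the bridge both [A] and $H$ gain a component, so the term of $H-e$ has the exponents of
   [e |: A]. The term of [A] has an extra factor $t^2(x-1)$, and the two sum to the factor $X$. *)
rewrite (bridge_nullity be eB) (bridge_ncomp be eB) ncomp_setC1 be addn1 subSS.
rewrite subSn ?ncomp_sub_ge // csub_weight_halfS csub_weightSl.
by rewrite mulrA /argX mulrDl mul1r.
Qed.

Lemma heg_tutte_loop (H : heg) (e : edge H) : is_loop e ->
  heg_tutte H x y t = argY y t * heg_tutte (contract e) x y t.
Proof.
move=> le; have -> : contract e = delete e by rewrite /contract le.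
rewrite (heg_tutte_split e) heg_tutte_delete mulr_sumr.
apply: eq_bigr => B _; cbv zeta; have eB := notin_imset_val B.
(* Relative to the term of $H-e$, leaving out the loop costs $t^2$ for the cut and keeping it costs
   $y-1$; the sum is $Y$. *)
rewrite (loop_nullity le eB) -(loop_ncomp _ le) ncomp_setC1 (loop_not_bridge le) addn0.
by rewrite csub_weight_halfS csub_weightSm -mulrDl /argY addrA [t ^+ 2 + y]addrC.
Qed.

Lemma heg_tutte_ordinary (H : heg) (e : edge H) : is_ordinary e ->
  heg_tutte H x y t =
  t ^+ 2 * heg_tutte (delete e) x y t + heg_tutte (contract e) x y t.
Proof.
move=> /andP[/negPf nbe nle].
rewrite (heg_tutte_split e) heg_tutte_delete heg_tutte_contract // mulr_sumr -big_split.
apply: eq_bigr => B _; cbv zeta; rewrite ncomp_setC1 nbe addn0; congr (_ + _).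
by rewrite csub_weight_halfS.
Qed.

End HegTutte.

(** * Cuts, and assembly of the four statements *)

Lemma card_half_edge_csub (H : heg) (A : {set edge H}) :
  #|half_edge (spanning_csub A)| = (#|half_edge H| + 2 * #|~: A|)%N.
Proof.
rewrite card_sum card_prod card_bool mulnC card_sig; congr (_ + 2 * _)%N.
by apply: eq_card => f; rewrite !inE.
Qed.

(** The cut and the deletion have the same underlying graph; only the power of [t] in front changes,
    by the two new half-edges. *)
Lemma heg_tutte_cut (R : comUnitRingType) (x y t : R) (H : heg) (e : edge H) :
  heg_tutte (cut e) x y t = t ^+ 2 * heg_tutte (delete e) x y t.
Proof.
rewrite /heg_tutte mulrA -exprD card_half_edge_csub setCK cards1 muln1.
by rewrite [(_ + 2)%N]addnC -addnA.
Qed.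

Theorem proposition2p9 (R : comUnitRingType) (x y t : R)
    (ht : t \is a GRing.unit) :
  (forall (n : nat) (K : heg), is_edgeless n K ->
     heg_tutte K x y t = t ^+ #|half_edge K|)
  /\
  (forall (H : heg) (e : edge H),
     (is_bridge e ->
        heg_tutte H x y t = argX x t * heg_tutte (delete e) x y t) /\
     (is_loop e ->
        heg_tutte H x y t = argY y t * heg_tutte (contract e) x y t) /\
     (is_ordinary e ->
        heg_tutte H x y t = t ^+ 2 * heg_tutte (delete e) x y t
                            + heg_tutte (contract e) x y t))
  /\
  (forall (H : heg) (e : edge H), is_ordinary e ->
     heg_tutte H x y t = heg_tutte (cut e) x y t
                         + heg_tutte (contract e) x y t)
  /\
  (forall H : heg,
     heg_tutte H x y t =
     \sum_(A : {set edge H})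
        (x - 1) ^+ (rank H - rank (spanning_csub A)) *
        (y - 1) ^+ nullity (spanning_csub A) *
        t ^+ #|half_edge (spanning_csub A)|).
Proof.
split=> [n K [_ E0]|].
  have E A : #|A : {set edge K}| = 0%N by apply/eqP; rewrite -leqn0 -E0 max_card.
  have A0 (A : {set edge K}) : A = set0 by apply: cards0_eq.
  rewrite heg_tutteE // (bigD1 set0) //= big1 ?addr0 => [|A]; last by rewrite (A0 A) eqxx.
  (* With no edges, rank plus nullity is zero for [K] and for its only spanning subgraph, so every
     exponent vanishes except the number of half-edges. *)
  have := rank_nullity K; have := @rank_nullity (spanning_subgraph (set0 : {set edge K})).
  rewrite E0 card_edge_sub cards0 => /eqP; rewrite addn_eq0 => /andP[_ /eqP ->].
  move=> /eqP; rewrite addn_eq0 => /andP[/eqP -> _].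
  by rewrite /csub_weight sub0n E muln0 addn0 !expr0 !mul1r.
split; first by move=> H e; split; [|split];
  [exact: heg_tutte_bridge|exact: heg_tutte_loop|exact: heg_tutte_ordinary].
split=> [H e oe|H]; first by rewrite (heg_tutte_ordinary _ _ ht oe) heg_tutte_cut.
by rewrite heg_tutteE //; apply: eq_bigr => A _; rewrite card_half_edge_csub.
Qed.
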